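(* Let $A \subset E^2$ be a convex body in the Euclidean plane and let $H_A$ be an affine-regular hexagon inscribed in $A$. Then the centroid of $A$ belongs to the homothetic image of $H_A$ with ratio $\frac{4}{21}$ and center of homothety at the center of $H_A$; that is, if $c$ denotes the center of $H_A$, then the centroid of $A$ lies in $\{\, c + \frac{4}{21}(x-c) : x \in H_A \,\}$.
   Context: $E^2$ is the Euclidean plane. A planar convex body is a closed bounded convex subset of $E^2$ (any such set containing an inscribed affine-regular hexagon has non-empty interior). An affine-regular hexagon is the image of a regular hexagon (as a convex region) under a non-degenerate affine map of the plane; its center is the image of the center of the regular hexagon, i.e. its center of symmetry. A hexagon is inscribed in $A$ if all its vertices lie on the boundary of $A$ (so, by convexity, the hexagon is contained in $A$). The centroid of $A$ is its center of mass with respect to area, $\frac{1}{\mathrm{area}(A)}\int_A x\,dx$. *)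

(* Defs.v *)
From HB Require Import structures.
From mathcomp Require Import all_boot all_order all_algebra.
From mathcomp Require Import all_classical all_reals all_analysis.

Set Implicit Arguments.
Unset Strict Implicit.
Unset Printing Implicit Defensive.

Import Order.TTheory GRing.Theory Num.Theory.
Import numFieldNormedType.Exports.

Local Open Scope classical_set_scope.
Local Open Scope ring_scope.

(* [R^o] rather than [R], so that the product is a normed module over [R].
   Its norm is the sup norm, which has the Euclidean topology and bounded
   sets; Euclidean distances enter only through [regular_hexagon_vertex]. *)
Definition plane (R : realType) : normedModType R := (R^o * R^o)%type.

Section Plane.
Context {R : realType}.
Local Notation E2 := (plane R).
Implicit Types (A H : set E2) (c o : E2).

Definition convex_body A : Prop :=
  [/\ closed A, bounded_set A & convex_set A].

Definition boundary A : set E2 := closure A `\` interior A.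

Definition convex_hull A : set E2 := smallest (@convex_set R E2) A.

Definition regular_hexagon_vertex o (r theta : R) (k : 'I_6) : E2 :=
  o + (r * cos (theta + k%:R * (pi / 3)), r * sin (theta + k%:R * (pi / 3))).

Definition regular_hexagon o (r theta : R) : set E2 :=
  convex_hull (range (regular_hexagon_vertex o r theta)).

Definition nondegenerate_affine (T : E2 -> E2) : Prop :=
  exists (L : {linear E2 -> E2}) (b : E2),
    bijective L /\ forall x, T x = L x + b.

(* [H] is an affine-regular hexagon (as a convex region) with vertices [v]
   and center [c]. *)
Definition affine_regular_hexagon H (v : 'I_6 -> E2) c : Prop :=
  exists (T : E2 -> E2) (o : E2) (r theta : R),
    [/\ nondegenerate_affine T, 0 < r,
        H = T @` regular_hexagon o r theta,
        (forall k, v k = T (regular_hexagon_vertex o r theta k)) & c = T o].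

Definition inscribed (v : 'I_6 -> E2) A : Prop :=
  forall k, boundary A (v k).

Definition area :
    {measure set (measurableTypeR R * measurableTypeR R) -> \bar R} :=
  (@lebesgue_measure R \x @lebesgue_measure R)%E.

Definition centroid A : E2 :=
  (fine (area A))^-1 *:
    ((\int[area]_(x in A) x.1, \int[area]_(x in A) x.2) : E2).

Definition homothety c (k : R) (x : E2) : E2 := c + k *: (x - c).

End Plane.

(* Main.v *)
Require Import Defs.
From mathcomp Require Import all_boot all_order all_algebra.
From mathcomp Require Import all_classical all_reals all_analysis.
From mathcomp Require Import measurable_realfun ring lra.
Import Order.TTheory GRing.Theory Num.Theory.
Import numFieldNormedType.Exports.
Local Open Scope classical_set_scope.
Local Open Scope ring_scope.

Set Implicit Arguments.
Unset Strict Implicit.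

(* Normalize the hexagon affinely to H = {|x|, |y|, |x + y| <= 1}.  The order 6
   rotation of H permutes its edges, so it suffices to bound the ordinate of
   the centroid, i.e. to show that the integral of y - 4/21 over A is <= 0.
   Supporting lines of A at the vertices (0, 1) and (-1, 1) are y = 1 - p x and
   y = 1 + q (x + y) with p, q in [0, 1]; by reflection, p <= q.  Then the part
   of A above y = 1 lies in the triangle (0, 1), (-1, 1), (-1, 1 + p), and the
   part of A \ H with 0 < y <= 1 lies in the triangle (1, 0), (0, 1), (1, 1 - p)
   and its mirror image, where y - 4/21 <= (17/21) y.  With the part of A \ H
   below the x-axis discarded, the integral is at most
   area * (p - 1) (55 p + 4) / 63 <= 0, where area is that of the triangle
   (0, 0), (1, 0), (0, 1).  Moments of triangles are obtained from the affine
   invariance of the Lebesgue measure and the symmetries of the triangle. *)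

(* The measure structure of [pushforward] depends on a measurability proof that
   unification cannot find; this notation allows passing it explicitly. *)
Local Notation pushforward_measure :=
  measure_function_pushforward__canonical__measure_function_Measure.

(** * Affine change of variables *)
Section AreaTransformation.
Context {R : realType}.
Local Notation P := (measurableTypeR R * measurableTypeR R)%type.
Local Notation leb := (@lebesgue_measure R).
Local Notation area := (@area R).

Lemma measurable_affine (a b : R) :
  measurable_fun [set: measurableTypeR R]
    ((fun y => a * y + b) : measurableTypeR R -> measurableTypeR R).
Proof. by apply: measurable_funD => //; exact: measurable_funM. Qed.

(** By uniqueness of the Lebesgue measure: [m'], the pushforward along [f] multiplied by [|a|],
    agrees with it on half-open intervals. *)
Lemma lebesgue_measure_affine (a b : R) (B : set (measurableTypeR R)) :
  a != 0 -> measurable B ->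
  leb ((fun y => a * y + b) @^-1` B) = ((`|a|^-1)%:E * leb B)%E.
Proof.
move=> a0 mB.
pose f : measurableTypeR R -> measurableTypeR R := fun y => a * y + b.
have mf : measurable_fun setT f by exact: measurable_affine.
have a'0 : 0 <= `|a| by [].
have an0 : `|a| != 0 by rewrite normr_eq0.
pose m' := mscale (NngNum a'0) (pushforward_measure leb mf).
suff H : leb B = m' B.
  by rewrite H /m' /mscale/= muleA -EFinM mulVf// mul1e.
apply: (@lebesgue_measure_unique R m') => //.
move=> _ [[u v]] _ <-.
rewrite /m' /mscale/= /pushforward.
change (leb `]u, v]%classic = (`|a|%:E * leb (f @^-1` `]u, v]%classic))%E).
have [agt0|alt0] : 0 < a \/ a < 0.
- by move: a0; rewrite neq_lt => /orP[]; [right|left].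
- have -> : f @^-1` [set` Interval (BRight u) (BRight v)] =
    [set` Interval (BRight ((u - b) / a)) (BRight ((v - b) / a))].
    apply/seteqP; split => y /=; rewrite !in_itv/= /f ltr_pdivrMr// ler_pdivlMr//
      ltrBlDr lerBrDr (mulrC y); by [].
  rewrite !lebesgue_measure_itv/= !lte_fin ltr_pM2r ?invr_gt0// ltrD2r.
  case: ifPn => // uv; last by rewrite mule0.
  rewrite -!EFinB -EFinM gtr0_norm//; congr EFin; field; exact: lt0r_neq0.
(* A negative slope exchanges the endpoints, so the preimage is closed on the left instead of the
   right; its length is the same. *)
- have -> : f @^-1` [set` Interval (BRight u) (BRight v)] =
    [set` Interval (BLeft ((v - b) / a)) (BLeft ((u - b) / a))].
    apply/seteqP; split => y /=; rewrite !in_itv/= /f ltr_ndivlMr// ler_ndivrMr//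
      ltrBlDr lerBrDr (mulrC y) andbC; by [].
  rewrite !lebesgue_measure_itv/= !lte_fin ltr_nM2r ?invr_lt0// ltrD2r.
  case: ifPn => // uv; last by rewrite mule0.
  rewrite -!EFinB -EFinM ltr0_norm//; congr EFin; field; exact: ltr0_neq0.
Qed.

(** The factor is the one for preimages: the inverse of the absolute value of the determinant when
    [T] is affine. *)
Definition rescales_area (T : P -> P) (k : R) :=
  [/\ 0 < k, measurable_fun setT T &
    forall S, measurable S -> area (T @^-1` S) = (k%:E * area S)%E].

Lemma rescales_area_comp (T U : P -> P) (k l : R) :
  rescales_area T k -> rescales_area U l ->
  rescales_area (T \o U) (k * l).
Proof.
move=> [k0 mT HT] [l0 mU HU]; split; first exact: mulr_gt0.
  exact: measurableT_comp.
move=> S mS; rewrite comp_preimage HU.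
  by rewrite HT// muleA -EFinM mulrC.
by rewrite -[X in measurable X]setTI; exact: mT.
Qed.

Lemma rescales_area_swap : rescales_area (fun z => (z.2, z.1)) 1.
Proof.
pose f : P -> P := fun z => (z.2, z.1).
have mf : measurable_fun setT f.
  by apply/measurable_fun_pairP; split; [exact: measurable_snd|exact: measurable_fst].
split => // S mS; rewrite mul1e.
symmetry.
suff H : area S = pushforward area f S by exact: H.
apply: (@product_measure_unique _ _ _ _ _ leb leb (pushforward_measure area mf)) => //.
move=> A B mA mB; change (area (f @^-1` (A `*` B)) = (leb A * leb B)%E).
have -> : f @^-1` (A `*` B) = B `*` A.
  by apply/seteqP; split => -[x y] /=; rewrite /f/= => -[].
by rewrite muleC -product_measure1E.
Qed.

(** The vertical section of the preimage over [x] is the preimage of the section of [S] under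
    [y -> a * y + (b * x + e)], so the one-dimensional scaling applies section by section. *)
Lemma rescales_area_shear (a b e : R) : a != 0 ->
  rescales_area (fun z => (z.1, a * z.2 + b * z.1 + e)) `|a|^-1.
Proof.
move=> a0; set f : P -> P := fun z => _.
have mf : measurable_fun setT f.
  apply/measurable_fun_pairP; split; first exact: measurable_fst.
  apply: measurable_funD => //; apply: measurable_funD; apply: measurable_funM => //.
split => // [|S mS]; first by rewrite invr_gt0 normr_gt0.
rewrite /area /= /product_measure1 /=.
rewrite -ge0_integralZl//=; last exact: measurable_fun_xsection.
apply: eq_integral => x _.
rewrite -(@lebesgue_measure_affine a (b * x + e))//; last exact: measurable_xsection.
congr (leb _); apply/seteqP; split => y /=; rewrite /xsection /preimage/= !inE /f /=;
  by rewrite -addrA.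
Qed.

Definition affine_map (a b c d e f : R) (z : P) : P :=
  (a * z.1 + b * z.2 + e, c * z.1 + d * z.2 + f).

(** For [a != 0] the map factors into two shears, one of them conjugated by the swap. For [a = 0],
    [b] is nonzero and swapping the coordinates reduces to the first case. *)
Lemma rescales_area_affine (a b c d e f : R) : a * d - b * c != 0 ->
  rescales_area (affine_map a b c d e f) `|a * d - b * c|^-1.
Proof.
have main a' b' c' d' e' f' : a' != 0 -> a' * d' - b' * c' != 0 ->
    rescales_area (affine_map a' b' c' d' e' f') `|a' * d' - b' * c'|^-1.
  move=> a0 D0.
  have da : (a' * d' - b' * c') / a' != 0 by rewrite mulf_neq0// invr_eq0.
  (* [H1] installs the new first coordinate. [H2] adds [c' / a'] times it to the second one, which
     leaves [(a' * d' - b' * c') / a'] as the coefficient of [y]. *)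
  have H1 := rescales_area_comp rescales_area_swap
    (rescales_area_comp (rescales_area_shear b' e' a0) rescales_area_swap).
  have H2 := rescales_area_comp
    (rescales_area_shear (c' / a') (f' - c' / a' * e') da) H1.
  have -> : `|a' * d' - b' * c'|^-1 =
     `|(a' * d' - b' * c') / a'|^-1 * (1 * (`|a'|^-1 * 1)).
    rewrite mulr1 mul1r normrM normfV invfM invrK -mulrA divff ?mulr1//.
    by rewrite normr_eq0.
  set g := (g in rescales_area g _) in H2.
  suff -> : affine_map a' b' c' d' e' f' = g by [].
  by apply/funext => -[x y]; rewrite /g /affine_map /=; congr (_, _); field.
move=> D0; have [a0|a0] := eqVneq a 0; last exact: main.
have b0 : b != 0 by apply: contraNneq D0 => ->; rewrite a0 !mul0r subrr.
have D0' : b * c - a * d != 0 by rewrite -oppr_eq0 opprB.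
have := rescales_area_comp (main b a d c e f b0 D0') rescales_area_swap.
rewrite mulr1 distrC.
set g := (g in rescales_area g _); suff -> : affine_map a b c d e f = g by [].
by apply/funext => -[x y]; rewrite /g /affine_map /=; congr (_, _); ring.
Qed.

End AreaTransformation.

(** * Integration in the plane *)
Section PlaneIntegral.
Context {R : realType}.
Local Notation P := (measurableTypeR R * measurableTypeR R)%type.
Local Notation leb := (@lebesgue_measure R).
Local Notation area := (@area R).
Implicit Types (g h : P -> R) (S : set P).

Definition intg g := area.-integrable setT (EFin \o g).
Definition J g : R := \int[area]_z g z.

(** The pushforward of [area] along [T] is [k] times [area]. *)
Lemma ge0_integral_rescale (T : P -> P) (k : R) (g : P -> \bar R) :
  rescales_area T k -> measurable_fun setT g -> (forall z, 0 <= g z)%E ->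
  (\int[area]_z g (T z) = k%:E * \int[area]_z g z)%E.
Proof.
move=> [k0 mT HT] mg g0.
transitivity (\int[pushforward_measure area mT]_z g z)%E.
  by rewrite (ge0_integral_pushforward mT)//.
rewrite (eq_measure_integral (mscale (NngNum (ltW k0)) area)); last first.
  by move=> S mS _; exact: HT.
by rewrite ge0_integral_mscale.
Qed.

Lemma intg_rescale (T : P -> P) (k : R) g :
  rescales_area T k -> intg g -> intg (g \o T).
Proof.
move=> HT /integrableP[mg fg]; have [k0 mT _] := HT.
apply/integrableP; split.
  exact: (measurableT_comp mg mT).
have -> : (\int[area]_z `|(EFin \o (g \o T)) z| =
   k%:E * \int[area]_z `|(EFin \o g) z|)%E.
  rewrite -(@ge0_integral_rescale T k (fun z => `|(EFin \o g) z|%E))//.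
  exact: measurableT_comp.
by rewrite lte_mul_pinfty// ?lee_fin ?ltW.
Qed.

Lemma J_rescale (T : P -> P) (k : R) g :
  rescales_area T k -> intg g -> J (g \o T) = k * J g.
Proof.
move=> HT ig; have [k0 mT _] := HT.
have fg := integrable_fin_num measurableT ig.
have [mg _] := integrableP _ _ _ ig.
rewrite /J /Rintegral.
have -> : (\int[area]_z ((g \o T) z)%:E = k%:E * \int[area]_z (g z)%:E)%E.
  rewrite integralE [X in (_ * X)%E]integralE.
  have mp : measurable_fun setT (EFin \o g)^\+%E by exact: measurable_funepos.
  have mn : measurable_fun setT (EFin \o g)^\-%E by exact: measurable_funeneg.
  rewrite muleBr//; last exact: (integrable_add_def measurableT ig).
  rewrite -(@ge0_integral_rescale T k (fun z => (EFin \o g)^\+ z)%E)//.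
  rewrite -(@ge0_integral_rescale T k (fun z => (EFin \o g)^\- z)%E)//.
  by congr (_ - _)%E; apply: eq_integral => z _; rewrite ?funeposE ?funenegE.
by rewrite fineM.
Qed.

Lemma intgD g h : intg g -> intg h -> intg (fun z => g z + h z).
Proof. by move=> ig ih; exact: (integrableD measurableT ig ih). Qed.

Lemma intgZ k g : intg g -> intg (fun z => k * g z).
Proof. by move=> ig; exact: (integrableZl measurableT k ig). Qed.

Lemma JD g h : intg g -> intg h -> J (fun z => g z + h z) = J g + J h.
Proof. by move=> ig ih; exact: RintegralD. Qed.

Lemma JZ k g : intg g -> J (fun z => k * g z) = k * J g.
Proof. by move=> ig; exact: RintegralZl. Qed.

Lemma le_J g h : intg g -> intg h -> (forall z, g z <= h z) -> J g <= J h.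
Proof. by move=> ig ih gh; apply: le_Rintegral => // z _; exact: gh. Qed.

Definition affine_fun (a b c : R) (z : P) : R := a * z.1 + b * z.2 + c.

Lemma measurable_affine_fun a b c : measurable_fun setT (affine_fun a b c).
Proof.
by apply: measurable_funD => //; apply: measurable_funD => //; apply: measurable_funM.
Qed.

Lemma measurable_closed_half_plane a b c :
  measurable [set z : P | 0 <= affine_fun a b c z].
Proof.
have := @measurable_affine_fun a b c measurableT `[0, +oo[%classic.
rewrite setTI; have -> : affine_fun a b c @^-1` `[0, +oo[ =
  [set z | 0 <= affine_fun a b c z].
  by apply/seteqP; split => z /=; rewrite in_itv/= andbT.
by apply; exact: measurable_itv.
Qed.

Lemma measurable_open_half_plane a b c :
  measurable [set z : P | 0 < affine_fun a b c z].
Proof.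
have := @measurable_affine_fun a b c measurableT `]0, +oo[%classic.
rewrite setTI; have -> : affine_fun a b c @^-1` `]0, +oo[ =
  [set z | 0 < affine_fun a b c z].
  by apply/seteqP; split => z /=; rewrite in_itv/= andbT.
by apply; exact: measurable_itv.
Qed.

Definition bounded_region S := measurable S /\
  exists M : R, forall z, S z -> `|z.1| <= M /\ `|z.2| <= M.

Lemma area_bounded_region S : bounded_region S -> (area S < +oo)%E.
Proof.
move=> [mS [M HM]].
have mI : measurable (`[- M, M]%classic : set (measurableTypeR R)) by exact: measurable_itv.
apply: (@le_lt_trans _ _ (area (`[- M, M] `*` `[- M, M]))).
  apply: le_measure; rewrite ?inE//; first exact: measurableX.
  by move=> z /HM[]; rewrite !ler_norml /= !in_itv.
have -> : area (`[- M, M] `*` `[- M, M]) = (leb `[(- M)%R, M] * leb `[(- M)%R, M])%E.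
  by rewrite -product_measure1E.
rewrite !lebesgue_measure_itv/=; case: ifPn => _; last by rewrite mul0e.
by rewrite -EFinB -EFinM ltry.
Qed.

(** Carrying the domain as an indicator keeps every integral over the whole plane, where integrands
    can be compared pointwise and composed with affine maps. Coefficients [1 0 0] and [0 1 0] give
    the first moments of [S], and [0 0 1] its area. *)
Definition weight S a b c z : R := \1_S z * affine_fun a b c z.

Lemma intg_weight S a b c : bounded_region S -> intg (weight S a b c).
Proof.
move=> bS; have [mS [M HM]] := bS.
have -> : intg (weight S a b c) =
  area.-integrable setT ((EFin \o affine_fun a b c) \_ S)%E.
  congr (integrable _ _ _); apply/funext => z.
  rewrite /weight /patch /= indicE; case: ifPn => _; by rewrite ?mul1r ?mul0r.
apply/(integrable_mkcond _ mS).
apply: measurable_bounded_integrable => //.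
- exact: area_bounded_region.
- by apply: measurable_funTS; exact: measurable_affine_fun.
- exists (`|a| * M + `|b| * M + `|c|); split; first exact: num_real.
  move=> N HN z Sz; apply: le_trans (ltW HN).
  have [h1 h2] := HM z Sz.
  rewrite /affine_fun (le_trans (ler_normD _ _))// lerD2r.
  by rewrite (le_trans (ler_normD _ _))// !normrM lerD// ler_wpM2l.
Qed.

Lemma J_weight S a b c : bounded_region S ->
  J (weight S a b c) =
    a * J (weight S 1 0 0) + b * J (weight S 0 1 0) + c * J (weight S 0 0 1).
Proof.
move=> bS; rewrite -!JZ; try exact: intg_weight.
rewrite -!JD; try (by apply: intgZ; exact: intg_weight).
  by congr J; apply/funext => z; rewrite /weight /affine_fun; ring.
by apply: intgD; apply: intgZ; exact: intg_weight.
Qed.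

Lemma weight_comp S a b c (a' b' c' d' e' f' : R) :
  weight S a b c \o affine_map a' b' c' d' e' f' =
  weight (affine_map a' b' c' d' e' f' @^-1` S)
    (a * a' + b * c') (a * b' + b * d') (a * e' + b * f' + c).
Proof.
apply/funext => z; rewrite /weight /affine_fun /affine_map /= !indicE.
congr (_ * _); ring.
Qed.

(** [U] is the countable union of the rational open boxes that it contains; balls of the sup norm
    are squares, so such a box exists around each point of [U]. *)
Lemma open_measurable_plane (U : set (plane R)) : open U ->
  measurable (U : set P).
Proof.
move=> oU.
pose box (q : (rat * rat) * (rat * rat)) : set P :=
  `](ratr q.1.1), (ratr q.1.2)[ `*` `](ratr q.2.1), (ratr q.2.2)[.
have -> : U = \bigcup_q (if pselect (box q `<=` U) then box q else set0).
  apply/seteqP; split => [[x y] Uz|z [q _]]; last by case: pselect => // h /h.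
  have /nbhs_ballP[e /= e0 He] : nbhs ((x, y) : plane R) U by exact: open_nbhs_nbhs.
  have H t : exists p q : rat, t - e < ratr p /\ ratr p < t /\ t < ratr q /\ ratr q < t + e.
    have /rat_in_itvoo[p] : t - e < t by rewrite ltrBlDr ltrDl.
    rewrite in_itv/= => /andP[p1 p2].
    have /rat_in_itvoo[q] : t < t + e by rewrite ltrDl.
    by rewrite in_itv/= => /andP[q1 q2]; exists p, q.
  have [p1 [q1 [h1 [h2 [h3 h4]]]]] := H x.
  have [p2 [q2 [k1 [k2 [k3 k4]]]]] := H y.
  exists ((p1, q1), (p2, q2)) => //; case: pselect => /= [_|].
    by split; rewrite /= in_itv/=; apply/andP.
  case=> -[u v] [] /=; rewrite !in_itv/= => /andP[u1 u2] /andP[v1 v2].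
  apply: He; split; rewrite /= /ball/= ltr_norml; apply/andP; split; lra.
apply: countable_bigcupT_measurable => [|q]; first exact: countableP.
case: (pselect (box q `<=` U)) => h; last exact: measurable0.
by apply: measurableX; exact: measurable_itv.
Qed.

Lemma closed_measurable_plane (A : set (plane R)) : closed A ->
  measurable (A : set P).
Proof.
move=> cA; rewrite -(setCK A); apply: measurableC.
by apply: open_measurable_plane; exact: closed_openC.
Qed.

End PlaneIntegral.

(** * Triangles and the standard hexagon *)
Section TriangleIntegrals.
Context {R : realType}.
Local Notation P := (measurableTypeR R * measurableTypeR R)%type.
Local Notation leb := (@lebesgue_measure R).
Local Notation area := (@area R).
Implicit Types (g h : P -> R) (S : set P).

Lemma indicP S z : (S z /\ \1_S z = 1 :> R) \/ (~ S z /\ \1_S z = 0 :> R).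
Proof.
rewrite indicE; case: (pselect (S z)) => h; [left|right]; split => //.
  by rewrite mem_set.
by rewrite memNset.
Qed.

(** Cramer's rule expresses [x] and [y] through [u - e] and [v - f] with denominator [D], whence the
    explicit bound. *)
Lemma bounded_region_preimage (a b c d e f : R) S : a * d - b * c != 0 ->
  bounded_region S -> bounded_region (affine_map a b c d e f @^-1` S).
Proof.
move=> D0 [mS [M HM]]; split.
  have [_ mT _] := rescales_area_affine e f D0.
  by rewrite -[X in measurable X]setTI; exact: mT.
set D := a * d - b * c in D0.
exists ((`|d| * (M + `|e|) + `|b| * (M + `|f|) + `|c| * (M + `|e|)
   + `|a| * (M + `|f|)) / `|D|) => -[x y] /HM[] /=.
rewrite /affine_map /=; set u := a * x + b * y + e; set v := c * x + d * y + f.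
move=> hu hv.
have M0 : 0 <= M by exact: le_trans hu.
have nu : `|u - e| <= M + `|e| by rewrite (le_trans (ler_normB _ _))// lerD2r.
have nv : `|v - f| <= M + `|f| by rewrite (le_trans (ler_normB _ _))// lerD2r.
have P1 (k : R) : 0 <= `|k| * (M + `|e|) by rewrite mulr_ge0// addr_ge0.
have P2 (k : R) : 0 <= `|k| * (M + `|f|) by rewrite mulr_ge0// addr_ge0.
have D1 : 0 < `|D| by rewrite normr_gt0.
have Q1 (k : R) : `|k * (u - e)| <= `|k| * (M + `|e|) by rewrite normrM ler_wpM2l.
have Q2 (k : R) : `|k * (v - f)| <= `|k| * (M + `|f|) by rewrite normrM ler_wpM2l.
rewrite !ler_pdivlMr// -!normrM.
have -> : x * D = d * (u - e) - b * (v - f) by rewrite /D /u /v; ring.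
have -> : y * D = a * (v - f) - c * (u - e) by rewrite /D /u /v; ring.
have := P1 d; have := P1 c; have := P2 a; have := P2 b.
have := Q1 d; have := Q1 c; have := Q2 a; have := Q2 b.
move: (ler_normB (d * (u - e)) (b * (v - f))) (ler_normB (a * (v - f)) (c * (u - e))).
split; lra.
Qed.

Lemma J_affine_map (a b c d e f : R) g : a * d - b * c != 0 -> intg g ->
  J (g \o affine_map a b c d e f) = `|a * d - b * c|^-1 * J g.
Proof. by move=> D0 ig; apply: J_rescale => //; exact: rescales_area_affine. Qed.

Lemma intg_affine_map (a b c d e f : R) g : a * d - b * c != 0 -> intg g ->
  intg (g \o affine_map a b c d e f).
Proof. by move=> D0; apply: intg_rescale; exact: rescales_area_affine. Qed.

Lemma J_area S : measurable S -> J (weight S 0 0 1) = fine (area S).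
Proof.
move=> mS; rewrite /J /Rintegral; congr fine.
under eq_integral.
  move=> z _; rewrite /weight /affine_fun !mul0r !add0r mulr1.
  over.
by rewrite integral_indic// setIT.
Qed.

Definition triangle : set P := [set z | 0 <= z.1 /\ 0 <= z.2 /\ z.1 + z.2 <= 1].

Lemma half_planeI a b c S : measurable S ->
  measurable ([set z | 0 <= affine_fun a b c z] `&` S).
Proof. by move=> mS; apply: measurableI => //; exact: measurable_closed_half_plane. Qed.

Lemma bounded_region_triangle : bounded_region triangle.
Proof.
split.
  have := half_planeI 1 0 0 (half_planeI 0 1 0 (@measurable_closed_half_plane R (-1) (-1) 1)).
  congr measurable; apply/seteqP; rewrite /affine_fun /triangle; split => -[x y] /=.
    by move=> [? [? ?]]; do ?split; lra.
  by move=> [? [? ?]]; do ?split; lra.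
exists 1 => -[x y] [/= ? [? ?]]; rewrite !ler_norml; split; lra.
Qed.

(** The unit in which all later areas and moments are expressed; the final estimate depends only on
    its sign. *)
Definition triangle_area : R := J (weight triangle 0 0 1).

(** The map [(x, y) -> (y, 1 - x - y)] permutes the vertices cyclically and preserves area.
    Invariance of the two first moments yields two linear equations, which place the centroid at
    [(1/3, 1/3)]. *)
Lemma J_triangle a b c : J (weight triangle a b c) = triangle_area * (c + (a + b) / 3).
Proof.
have bT := bounded_region_triangle.
have D1 : 0 * (-1) - 1 * (-1) = 1 :> R by lra.
have D0 : 0 * (-1) - 1 * (-1) != 0 :> R by rewrite D1 oner_neq0.
have TT : affine_map 0 1 (-1) (-1) 0 1 @^-1` triangle = triangle :> set P.
  by apply/seteqP; rewrite /affine_map /triangle; split => -[x y] /= [? [? ?]]; do ?split; lra.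
have H a' b' c' := J_affine_map 0 1 D0 (intg_weight a' b' c' bT).
have H1 := H 1 0 0; have H2 := H 0 1 0.
rewrite weight_comp TT D1 normr1 invr1 mul1r J_weight// in H1.
rewrite weight_comp TT D1 normr1 invr1 mul1r J_weight// in H2.
rewrite J_weight// -/triangle_area.
move: H1 H2; rewrite -/triangle_area.
set X := J (weight triangle 1 0 0); set Y := J (weight triangle 0 1 0) => H1 H2.
have -> : X = triangle_area / 3 by lra.
have -> : Y = triangle_area / 3 by lra.
by field.
Qed.

Lemma J_rect (a b c d : R) : a <= b -> c <= d ->
  bounded_region (`[a, b] `*` `[c, d] : set P) /\
  J (weight (`[a, b] `*` `[c, d]) 0 0 1) = (b - a) * (d - c).
Proof.
move=> ab cd.
have mX : measurable (`[a, b] `*` `[c, d] : set P).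
  by apply: measurableX; exact: measurable_itv.
split.
  split => //; exists (`|a| + `|b| + `|c| + `|d|) => -[x y] [] /=.
  rewrite !in_itv/= => /andP[? ?] /andP[? ?].
  have := ler_norm b; have := ler_norm d.
  have := ler_norm (- a); have := ler_norm (- c); rewrite !normrN.
  have := normr_ge0 a; have := normr_ge0 b; have := normr_ge0 c; have := normr_ge0 d.
  by rewrite !ler_norml; split; lra.
rewrite J_area//.
have -> : area (`[a, b] `*` `[c, d]) = (leb `[a, b] * leb `[c, d])%E.
  by rewrite -product_measure1E//; exact: measurable_itv.
rewrite !lebesgue_measure_itv/= !lte_fin.
move: ab cd; rewrite !le_eqVlt => /orP[/eqP ->|->] /orP[/eqP ->|->] //=;
  by rewrite ?ltxx ?subrr ?mul0e ?mule0 ?mulr0 ?mul0r.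
Qed.

Lemma triangle_area_gt0 : 0 < triangle_area.
Proof.
have [bQ JQ] := @J_rect 0 (1/2) 0 (1/2) ltac:(lra) ltac:(lra).
apply: (@lt_le_trans _ _ ((1/2 - 0) * (1/2 - 0))); first by lra.
rewrite -JQ; apply: le_J.
- exact: intg_weight.
- by apply: intg_weight; exact: bounded_region_triangle.
move=> [x y]; rewrite /weight /affine_fun.
have [[]|[_]] := indicP (`[0, 1/2] `*` `[0, 1/2]) (x, y); last first.
  move=> ->; rewrite mul0r mulr_ge0 ?indicE//=; lra.
rewrite /= !in_itv/= => -[/andP[? ?] /andP[? ?]] ->.
have [[_ ->]|[h _]] := indicP triangle (x, y); first by lra.
exfalso; apply: h; rewrite /triangle /=; do ?split; lra.
Qed.

(** The leg on the [y]-axis is removed so that the six rotated copies are pairwise disjoint. *)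
Definition triangle' : set P := [set z | 0 < z.1 /\ 0 <= z.2 /\ z.1 + z.2 <= 1].

Lemma bounded_region_triangle' : bounded_region triangle'.
Proof.
split.
  have := measurableI _ _ (@measurable_open_half_plane R 1 0 0)
    (half_planeI 0 1 0 (@measurable_closed_half_plane R (-1) (-1) 1)).
  congr measurable; apply/seteqP; rewrite /affine_fun ?/triangle ?/triangle'; split => -[x y] /=.
    by move=> [? [? ?]]; do ?split; lra.
  by move=> [? [? ?]]; do ?split; lra.
exists 1 => -[x y] [/= ? [? ?]]; rewrite !ler_norml; split; lra.
Qed.

(** The removed leg lies in the degenerate rectangle [[0, 0] x [0, 1]], of area 0. *)
Lemma J_triangle'_ge : triangle_area <= J (weight triangle' 0 0 1).
Proof.
have [bQ JQ] := @J_rect 0 0 0 1 ltac:(lra) ltac:(lra).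
have b' := bounded_region_triangle'.
have <- : J (fun z => weight triangle' 0 0 1 z + weight (`[0, 0] `*` `[0, 1]) 0 0 1 z)
  = J (weight triangle' 0 0 1).
  rewrite (JD (intg_weight 0 0 1 b') (intg_weight 0 0 1 bQ)) JQ; ring.
apply: le_J.
- by apply: intg_weight; exact: bounded_region_triangle.
- by apply: intgD; exact: intg_weight.
move=> [x y]; rewrite /weight /affine_fun /=.
have [[[/= h1 [h2 h3]] ->]|[_ ->]] := indicP triangle (x, y); last first.
  by rewrite !indicE mul0r addr_ge0// mulr_ge0//; lra.
have [[_ ->]|[ha ->]] := indicP triangle' (x, y).
  by rewrite indicE; set u := (X in _ <= _ + X); have : 0 <= u; [rewrite /u mulr_ge0//|]; lra.
have [[_ ->]|[hb _]] := indicP (`[0, 0] `*` `[0, 1]) (x, y); first by lra.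
exfalso; apply: hb; rewrite /= !in_itv/=.
have x0 : x = 0.
  apply/eqP; rewrite eq_le h1 andbT leNgt; apply/negP => x0.
  by apply: ha.
by split; apply/andP; split; lra.
Qed.

Definition hexagon : set P := [set z |
  [/\ -1 <= z.1, z.1 <= 1, -1 <= z.2 & z.2 <= 1] /\ -1 <= z.1 + z.2 <= 1].

Lemma bounded_region_hexagon : bounded_region hexagon.
Proof.
split.
  have := half_planeI 1 0 1 (half_planeI (-1) 0 1 (half_planeI 0 1 1
   (half_planeI 0 (-1) 1 (half_planeI 1 1 1 (@measurable_closed_half_plane R (-1) (-1) 1))))).
  congr measurable; apply/seteqP; rewrite /affine_fun /hexagon; split => -[x y] /=.
    by move=> [? [? [? [? [? ?]]]]]; split; [split|apply/andP;split]; lra.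
  by move=> [[? ? ? ?] /andP[? ?]]; do ?split; lra.
exists 1 => -[x y] [/= [? ? ? ?] _]; rewrite !ler_norml; split; lra.
Qed.

(** The central symmetry preserves the hexagon and negates [y]. *)
Lemma J_hexagon_snd : J (weight hexagon 0 1 0) = 0.
Proof.
have bH := bounded_region_hexagon.
have D1 : (-1) * (-1) - 0 * 0 = 1 :> R by lra.
have D0 : (-1) * (-1) - 0 * 0 != 0 :> R by rewrite D1 oner_neq0.
have TT : affine_map (-1) 0 0 (-1) 0 0 @^-1` hexagon = hexagon :> set P.
  by apply/seteqP; rewrite /affine_map /hexagon; split => -[x y] /= [[? ? ? ?] /andP[? ?]];
     (split; [split|apply/andP;split]; lra).
have := J_affine_map 0 0 D0 (intg_weight 0 1 0 bH).
rewrite weight_comp TT D1 normr1 invr1 mul1r J_weight//; lra.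
Qed.

(** The six arguments form the orbit of [(x, y)] under the rotation of order 6. At most one of them
    lies in [triangle'], and then [(x, y)] is in the hexagon. *)
Lemma rotated_triangles_le (x y : R) :
  (\1_triangle' (x, y) + (\1_triangle' (- y, x + y)
    + (\1_triangle' (- x - y, x) + (\1_triangle' (- x, - y)
    + (\1_triangle' (y, - x - y) + \1_triangle' (x + y, - x))))) : R)
  <= \1_hexagon (x, y).
Proof.
have H (u v : R) : (0 < u /\ 0 <= v /\ u + v <= 1) /\ \1_triangle' (u, v) = 1 :> R
    \/ \1_triangle' (u, v) = 0 :> R.
  by have [[h ->]|[_ ->]] := indicP triangle' (u, v); [left|right].
have K : -1 <= x -> x <= 1 -> -1 <= y -> y <= 1 -> -1 <= x + y -> x + y <= 1 ->
    \1_hexagon (x, y) = 1 :> R.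
  move=> *; have [[_ ->//]|[hh _]] := indicP hexagon (x, y).
  by exfalso; apply: hh; (split; [split => /=|apply/andP; split => /=]).
have K0 : 0 <= \1_hexagon (x, y) :> R by rewrite indicE.
have [[[a1 [a2 a3]] ->]|->] := H x y; have [[[b1 [b2 b3]] ->]|->] := H (- y) (x + y);
  try (exfalso; lra);
have [[[c1 [c2 c3]] ->]|->] := H (- x - y) x; try (exfalso; lra);
have [[[d1 [d2 d3]] ->]|->] := H (- x) (- y); try (exfalso; lra);
have [[[e1 [e2 e3]] ->]|->] := H y (- x - y); try (exfalso; lra);
have [[[f1 [f2 f3]] ->]|->] := H (x + y) (- x); try (exfalso; lra);
  first [lra | rewrite K; lra].
Qed.

(** A lower bound is the useful direction: the area of the hexagon enters the final estimate with
    the negative factor [- (4 / 21)]. *)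
Lemma J_hexagon_ge : 6 * triangle_area <= J (weight hexagon 0 0 1).
Proof.
have b' := bounded_region_triangle'.
pose w := weight triangle' 0 0 1.
have iw : intg w by exact: intg_weight.
have E (a b c d : R) : a * d - b * c = 1 -> intg (w \o affine_map a b c d 0 0) /\
    J (w \o affine_map a b c d 0 0) = J w.
  move=> D1; have D0 : a * d - b * c != 0 by rewrite D1 oner_neq0.
  by split; [exact: intg_affine_map|rewrite J_affine_map// D1 normr1 invr1 mul1r].
have [i1 E1] := E 0 (-1) 1 1 ltac:(lra).
have [i2 E2] := E (-1) (-1) 1 0 ltac:(lra).
have [i3 E3] := E (-1) 0 0 (-1) ltac:(lra).
have [i4 E4] := E 0 1 (-1) (-1) ltac:(lra).
have [i5 E5] := E 1 1 (-1) 0 ltac:(lra).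
have i45 := intgD i4 i5; have i345 := intgD i3 i45; have i2345 := intgD i2 i345.
have i1s := intgD i1 i2345; have is' := intgD iw i1s.
have S6 := JD iw i1s.
rewrite (JD i1 i2345) (JD i2 i345) (JD i3 i45) (JD i4 i5) in S6.
rewrite E1 E2 E3 E4 E5 in S6.
have := J_triangle'_ge; rewrite -/w => h.
have : J w + (J w + (J w + (J w + (J w + J w)))) <= J (weight hexagon 0 0 1); last by lra.
rewrite -S6; apply: le_J => //.
  by apply: intg_weight; exact: bounded_region_hexagon.
move=> [x y]; have := rotated_triangles_le x y.
rewrite /w /weight /affine_fun /affine_map /= !mul0r !mul1r !mulN1r !addr0 !add0r !mulr1.
by [].
Qed.

(** [r] is the ordinate restricted to the triangle [(1, 0)], [(0, 1)], [(1, 1 - p)]. For [p = 1]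
    this triangle is flat, no point meets the last four conditions, and [r = 0] serves. *)
Lemma right_triangle_bound (p : R) : 0 <= p <= 1 ->
  exists r : P -> R, [/\ intg r, J r = triangle_area * ((1 - p) * (2 - p) / 3),
    (forall z, 0 <= r z) &
    forall z, 1 < z.1 + z.2 -> z.1 <= 1 -> z.2 <= 1 - p * z.1 -> 0 <= z.2 ->
      z.2 <= r z].
Proof.
move=> /andP[p0 p1]; have bT := bounded_region_triangle.
have [p1'|p1'] := eqVneq p 1.
  exists (weight triangle 0 0 0); split.
  - exact: intg_weight.
  - by rewrite J_triangle p1'; ring.
  - by move=> z; rewrite /weight /affine_fun !mul0r !addr0 mulr0.
  - by move=> [x y] /=; rewrite p1'; lra.
have q0 : 0 < 1 - p by rewrite subr_gt0 lt_neqAle p1'.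
have q0' : 1 - p != 0 by exact: lt0r_neq0.
set q := 1 - p in q0 q0' *.
have D1 : (-1) * q^-1 - 0 * q^-1 = - q^-1 :> R by ring.
have D0 : (-1) * q^-1 - 0 * q^-1 != 0 :> R by rewrite D1 oppr_eq0 invr_eq0.
have qi : 0 < q^-1 by rewrite invr_gt0.
have qq : q * q^-1 = 1 by rewrite divff.
(* The chart [(x, y) -> (1 - x, (x + y - 1) / q)] sends this triangle to the standard one, and
   [u + q * v] pulls back to [y]. *)
exists (weight triangle 1 q 0 \o affine_map (-1) 0 q^-1 q^-1 1 (- q^-1)); split.
- by apply: intg_affine_map => //; exact: intg_weight.
- rewrite J_affine_map//; last exact: intg_weight.
  rewrite D1 normrN gtr0_norm// invrK J_triangle /q; by field.
- move=> [x y]; rewrite /= /weight /affine_fun /affine_map /=.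
  have [[[/= h1 [h2 h3]] ->]|[_ ->]] :=
    indicP triangle (-1 * x + 0 * y + 1, q^-1 * x + q^-1 * y + - q^-1).
    by have := mulr_ge0 (ltW q0) h2; lra.
  by rewrite mul0r.
- move=> [x y] /= h1 h2 h3 h4; rewrite /weight /affine_fun /affine_map /=.
  have [[_ ->]|[h _]] := indicP triangle (-1 * x + 0 * y + 1, q^-1 * x + q^-1 * y + - q^-1).
    have -> : q * (q^-1 * x + q^-1 * y + - q^-1) = x + y - 1.
      by rewrite !mulrDr !mulrA mulrN qq; ring.
    by lra.
  exfalso; apply: h; rewrite /triangle /=.
  have -> : q^-1 * x + q^-1 * y + - q^-1 = (x + y - 1) / q by ring.
  split; first by lra.
  split; first by apply: divr_ge0; lra.
  rewrite addrC -lerBrDr ler_pdivrMr//; rewrite /q; lra.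
Qed.

(** [t] is [y - k] restricted to the triangle [(0, 1)], [(-1, 1)], [(-1, 1 + p)], which is flat for
    [p = 0]. The condition [k <= 1] makes [t] nonnegative. *)
Lemma top_triangle_bound (p k : R) : 0 <= p -> k <= 1 ->
  exists t : P -> R, [/\ intg t, J t = triangle_area * (p * (1 - k + p / 3)),
    (forall z, 0 <= t z) &
    forall z, 1 < z.2 -> -1 <= z.1 -> z.2 <= 1 - p * z.1 -> z.1 <= 0 ->
      z.2 - k <= t z].
Proof.
move=> p0 k1; have bT := bounded_region_triangle.
have [p1'|p1'] := eqVneq p 0.
  exists (weight triangle 0 0 0); split.
  - exact: intg_weight.
  - by rewrite J_triangle p1'; ring.
  - by move=> z; rewrite /weight /affine_fun !mul0r !addr0 mulr0.
  - by move=> [x y] /=; rewrite p1'; lra.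
have q0 : 0 < p by rewrite lt_neqAle eq_sym p1'.
have D1 : (-1) * p^-1 - (- p^-1) * 0 = - p^-1 :> R by ring.
have D0 : (-1) * p^-1 - (- p^-1) * 0 != 0 :> R by rewrite D1 oppr_eq0 invr_eq0.
have qi : 0 < p^-1 by rewrite invr_gt0.
have qq : p * p^-1 = 1 by rewrite divff.
(* The chart is [(x, y) -> (- x - (y - 1) / p, (y - 1) / p)], and [p * v + (1 - k)] pulls back to
   [y - k]. *)
exists (weight triangle 0 p (1 - k) \o affine_map (-1) (- p^-1) 0 p^-1 p^-1 (- p^-1)); split.
- by apply: intg_affine_map => //; exact: intg_weight.
- rewrite J_affine_map//; last exact: intg_weight.
  rewrite D1 normrN gtr0_norm// invrK J_triangle; by field.
- move=> [x y]; rewrite /= /weight /affine_fun /affine_map /=.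
  have [[[/= h1 [h2 h3]] ->]|[_ ->]] :=
    indicP triangle (-1 * x + - p^-1 * y + p^-1, 0 * x + p^-1 * y + - p^-1).
    by have := mulr_ge0 p0 h2; lra.
  by rewrite mul0r.
- move=> [x y] /= h1 h2 h3 h4; rewrite /weight /affine_fun /affine_map /=.
  have [[_ ->]|[h _]] := indicP triangle (-1 * x + - p^-1 * y + p^-1, 0 * x + p^-1 * y + - p^-1).
    have -> : p * (0 * x + p^-1 * y + - p^-1) = y - 1.
      by rewrite !mulrDr !mulrA mulrN qq; ring.
    by lra.
  exfalso; apply: h; rewrite /triangle /=.
  have -> : 0 * x + p^-1 * y + - p^-1 = (y - 1) / p by ring.
  have -> : -1 * x + - p^-1 * y + p^-1 = - x - (y - 1) / p by ring.
  split; first by rewrite subr_ge0 ler_pdivrMr//; lra.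
  split; first by apply: divr_ge0; lra.
  lra.
Qed.

End TriangleIntegrals.

(** * Convex regions around the standard hexagon *)
Section StandardPosition.
Context {R : realType}.
Local Notation P := (measurableTypeR R * measurableTypeR R)%type.
Implicit Types (S : set P).

Definition plane_convex S := forall x y u v t : R, S (x, y) -> S (u, v) ->
  0 <= t <= 1 -> S ((1 - t) * x + t * u, (1 - t) * y + t * v).

(** The center is the midpoint of two opposite vertices, and the signs of [x], [y] and [x + y] cut
    the hexagon into six triangles with apex there. *)
Lemma hexagon_sub_convex S : plane_convex S ->
  S (1, 0) -> S (0, 1) -> S (-1, 1) -> S (-1, 0) -> S (0, -1) -> S (1, -1) ->
  hexagon `<=` S.
Proof.
move=> cS s1 s2 s3 s4 s5 s6.
have S0 : S (0, 0).
  have := cS _ _ _ _ (1/2) s1 s4 ltac:(lra).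
  by congr S; congr (_, _); lra.
(* a point of the triangle 0, u, v lies on a segment from u to [0, v] *)
have tri (a b c d s t : R) : S (a, b) -> S (c, d) -> 0 <= s -> 0 <= t -> s + t <= 1 ->
    S (s * a + t * c, s * b + t * d).
  move=> h1 h2 hs ht hst.
  have [s1'|s1'] := eqVneq s 1.
    have t0 : t = 0 by lra.
    by have := h1; congr S; congr (_, _); rewrite s1' t0; ring.
  have q0 : 0 < 1 - s by rewrite subr_gt0 lt_neqAle s1'; lra.
  have q0' : 1 - s != 0 by exact: lt0r_neq0.
  have h3 := cS _ _ _ _ (t / (1 - s)) S0 h2.
  have h4 := cS _ _ _ _ s (h3 _) h1.
  have : S ((1 - s) * ((1 - t / (1 - s)) * 0 + t / (1 - s) * c) + s * a,
         (1 - s) * ((1 - t / (1 - s)) * 0 + t / (1 - s) * d) + s * b).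
    apply: h4; last by lra.
    by rewrite divr_ge0 ?(ltW q0)//= ler_pdivrMr//; lra.
  by congr S; congr (_, _); field.
move=> [x y] [[/= h1 h2 h3 h4] /andP[h5 h6]].
case: (lerP 0 x) => x0; case: (lerP 0 y) => y0.
- have := tri _ _ _ _ x y s1 s2 x0 y0 h6; congr S; congr (_, _); ring.
- case: (lerP 0 (x + y)) => xy0.
    have := tri _ _ _ _ (x + y) (- y) s1 s6 xy0 ltac:(lra) ltac:(lra).
    congr S; congr (_, _); ring.
  have := tri _ _ _ _ x (- x - y) s6 s5 ltac:(lra) ltac:(lra) ltac:(lra).
  congr S; congr (_, _); ring.
- case: (lerP 0 (x + y)) => xy0.
    have := tri _ _ _ _ (x + y) (- x) s2 s3 xy0 ltac:(lra) ltac:(lra).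
    congr S; congr (_, _); ring.
  have := tri _ _ _ _ y (- x - y) s3 s4 ltac:(lra) ltac:(lra) ltac:(lra).
  congr S; congr (_, _); ring.
- have := tri _ _ _ _ (- x) (- y) s4 s5 ltac:(lra) ltac:(lra) ltac:(lra).
  congr S; congr (_, _); ring.
Qed.

(* The last condition expresses that the vertices lie on the boundary. *)
Record standard S : Prop := Standard {
  standard_bounded : bounded_region S;
  standard_convex : plane_convex S;
  standard_vertices : [/\ S (1, 0), S (0, 1) & S (-1, 1)] /\
    [/\ S (-1, 0), S (0, -1) & S (1, -1)];
  standard_boundary : forall t : R, 1 < t ->
    [/\ ~ S (t, 0), ~ S (0, t) & ~ S (- t, t)] /\
    [/\ ~ S (- t, 0), ~ S (0, - t) & ~ S (t, - t)] }.

Lemma plane_convex_preimage (a b c d e f : R) S : plane_convex S ->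
  plane_convex (affine_map a b c d e f @^-1` S).
Proof.
move=> cS x y u v t; rewrite /affine_map /= => h1 h2 ht.
have := cS _ _ _ _ t h1 h2 ht.
by congr S; congr (_, _); ring.
Qed.

(** This map permutes the six vertices cyclically, starting with [(1, 0)], [(0, 1)], [(-1, 1)]. *)
Lemma affine_map_rotation x y :
  affine_map 0 (-1) 1 1 0 0 (x, y) = (- y, x + y) :> P.
Proof. by rewrite /affine_map /=; congr (_, _); ring. Qed.

(** This map keeps ordinates and exchanges the two upper vertices [(0, 1)] and [(-1, 1)], hence also
    their supporting lines. *)
Lemma affine_map_reflection x y :
  affine_map (-1) (-1) 0 1 0 0 (x, y) = (- x - y, y) :> P.
Proof. by rewrite /affine_map /=; congr (_, _); ring. Qed.

Lemma standard_rotation S : standard S ->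
  standard (affine_map 0 (-1) 1 1 0 0 @^-1` S).
Proof.
move=> [bS cS [[s1 s2 s3] [s4 s5 s6]] ht]; split.
- by apply: bounded_region_preimage => //; apply/eqP; lra.
- exact: plane_convex_preimage.
- rewrite /preimage /= !affine_map_rotation.
  by rewrite ?(oppr0, opprK, addr0, add0r, subr0, sub0r, subrr, addNr).
- move=> t /ht[[h1 h2 h3] [h4 h5 h6]].
  rewrite /preimage /= !affine_map_rotation.
  by rewrite ?(oppr0, opprK, addr0, add0r, subr0, sub0r, subrr, addNr).
Qed.

Lemma standard_reflection S : standard S ->
  standard (affine_map (-1) (-1) 0 1 0 0 @^-1` S).
Proof.
move=> [bS cS [[s1 s2 s3] [s4 s5 s6]] ht]; split.
- by apply: bounded_region_preimage => //; apply/eqP; lra.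
- exact: plane_convex_preimage.
- rewrite /preimage /= !affine_map_reflection.
  by rewrite ?(oppr0, opprK, addr0, add0r, subr0, sub0r, subrr, addNr).
- move=> t /ht[[h1 h2 h3] [h4 h5 h6]].
  rewrite /preimage /= !affine_map_reflection.
  by rewrite ?(oppr0, opprK, addr0, add0r, subr0, sub0r, subrr, addNr).
Qed.

(** A supporting line at [(0, 1)], found by separating slopes: [p] is the supremum of the slopes
    seen from points left of the axis, and every point to the right gives an upper bound for
    them. *)
Lemma standard_support S : standard S ->
  exists2 p : R, 0 <= p <= 1 & forall x y, S (x, y) -> y <= 1 - p * x.
Proof.
move=> [bS cS [[s1 s2 s3] [s4 s5 s6]] ht].
have axis y : S (0, y) -> y <= 1.
  by move=> h; rewrite leNgt; apply/negP => /ht[[_ + _] _]; exact.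
(* The segment joining a point on the left to one on the right meets the [y]-axis at height at most
   1. *)
have cross x y u v : S (x, y) -> S (u, v) -> x < 0 -> 0 < u ->
    u * (y - 1) <= x * (v - 1).
  move=> h1 h2 x0 u0.
  have d0 : 0 < u - x by lra.
  have : (u * y - x * v) / (u - x) <= 1.
    apply: axis; have := cS _ _ _ _ (- x / (u - x)) h1 h2.
    have -> : 0 <= - x / (u - x) <= 1.
      by rewrite divr_ge0 ?(ltW d0)//= ?ler_pdivrMr//; lra.
    move=> /(_ isT); congr S; congr (_, _); field; exact: lt0r_neq0.
  rewrite ler_pdivrMr// mul1r; lra.
pose E : set R := [set s | exists x y, [/\ S (x, y), x < 0 & s = (y - 1) / - x]].
(* The vertex [(-1, 1)] contributes the slope 0, and [(1, 0)] the bound 1; hence [0 <= p <= 1]. *)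
have E0 : E 0 by exists (-1), 1; split => //; rewrite ?subrr ?mul0r//; lra.
have ubE x y : S (x, y) -> 0 < x -> ubound E ((1 - y) / x).
  move=> h x0 _ [u [v [h' u0 ->]]].
  have := cross _ _ _ _ h' h u0 x0 => hc.
  have u0' : 0 < - u by lra.
  rewrite ler_pdivrMr// mulrAC ler_pdivlMr//; lra.
have ub1 : ubound E 1 by have := ubE _ _ s1 ltr01; rewrite subr0 divr1.
have hE : has_sup E by split; [exists 0|exists 1].
exists (sup E).
  apply/andP; split; first exact: (ub_le_sup hE.2).
  exact: ge_sup hE.1 ub1.
move=> x y h; case: (ltrgtP x 0) => x0.
- have : (y - 1) / - x <= sup E by apply: (ub_le_sup hE.2); exists x, y.
  rewrite ler_pdivrMr; lra.
- have : sup E <= (1 - y) / x by apply: ge_sup hE.1 _; exact: ubE.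
  rewrite ler_pdivlMr//; lra.
- by rewrite x0 mulr0 subr0; apply: axis; rewrite -x0.
Qed.

(** The segment from [(x, y)] to the vertex [(1, -1)] crosses the [x]-axis at abscissa
    [(x + y) / (1 + y)], which cannot exceed 1. *)
Lemma standard_fst_le1 S x y : standard S -> S (x, y) -> 0 <= y -> x <= 1.
Proof.
move=> [bS cS [[s1 s2 s3] [s4 s5 s6]] ht] h y0.
have d0 : 0 < 1 + y by lra.
have : S ((x + y) / (1 + y), 0).
  have := cS _ _ _ _ (y / (1 + y)) h s6.
  have -> : 0 <= y / (1 + y) <= 1.
    by rewrite divr_ge0 ?(ltW d0)//= ?ler_pdivrMr//; lra.
  move=> /(_ isT); congr S; congr (_, _); field; exact: lt0r_neq0.
move=> h'; have : (x + y) / (1 + y) <= 1.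
  by rewrite leNgt; apply/negP => /ht[[+ _ _] _]; exact.
rewrite ler_pdivrMr//; lra.
Qed.

(** The integrand is dominated pointwise by the sum [B] of the weight of the hexagon, [t], and
    [17 / 21] times [r + r'], where [r'] is the mirror image of [r]; the integral of [B] is explicit
    up to the area of the hexagon. *)
Lemma standard_weight_le_slopes S (p : R) : standard S -> 0 <= p <= 1 ->
  (forall x y, S (x, y) -> y <= 1 - p * x) ->
  (exists2 q, p <= q <= 1 & forall x y, S (x, y) -> y <= 1 + q * (x + y)) ->
  J (weight S 0 1 (- (4 / 21))) <= 0.
Proof.
move=> hS p01 hp [q /andP[pq q1] hq].
have [r [ir Jr r0 hr]] := right_triangle_bound p01.
have [p0 p1] := andP p01.
have k1 : 4 / 21 <= 1 :> R by lra.
have [t [it Jt t0 ht]] := top_triangle_bound p0 k1.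
have D1 : (-1) * 1 - (-1) * 0 = -1 :> R by ring.
have D0 : (-1) * 1 - (-1) * 0 != 0 :> R by rewrite D1 oppr_eq0 oner_neq0.
pose r' := r \o affine_map (-1) (-1) 0 1 0 0.
have ir' : intg r' by exact: intg_affine_map.
have Jr' : J r' = J r by rewrite J_affine_map// D1 normrN normr1 invr1 mul1r.
have bH := @bounded_region_hexagon R.
have iH := intg_weight 0 1 (- (4 / 21)) bH.
have i1 := intgD ir ir'; have i2 := intgZ (17 / 21) i1.
have i3 := intgD it i2; have i4 := intgD iH i3.
have JB := JD iH i3.
rewrite (JD it i2) (JZ _ i1) (JD ir ir') Jr' Jr Jt in JB.
rewrite J_weight// J_hexagon_snd in JB.
set B := (B in J B = _) in JB.
have : J (weight S 0 1 (- (4 / 21))) <= J B.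
  apply: le_J => //; first by apply: intg_weight; exact: standard_bounded hS.
  have [[s1 s2 s3] [s4 s5 s6]] := standard_vertices hS.
  have HS : hexagon `<=` S.
    by apply: hexagon_sub_convex => //; exact: standard_convex hS.
  clear JB; move=> [x y]; rewrite /B /weight /affine_fun /=.
  have rp : 0 <= r (x, y) by exact: r0.
  have rp' : 0 <= r' (x, y) by exact: r0.
  have tp : 0 <= t (x, y) by exact: t0.
  have [[hh ->]|[hh ->]] := indicP hexagon (x, y).
    have [[_ ->]|[ns _]] := indicP S (x, y); last by exfalso; apply: ns; exact: HS.
    by lra.
  have [[hs ->]|[_ ->]] := indicP S (x, y); last by lra.
  (* Below the [x]-axis and outside the hexagon the integrand is negative while [B] is
     nonnegative. *)
  case: (lerP y 0) => y0; first by lra.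
  have hpx := hp _ _ hs; have hqx := hq _ _ hs.
  have q0 : 0 <= q by lra.
  (* For [0 < y <= 1] one has [y - 4 / 21 <= (17 / 21) * y], and [y] is at most [r] to the right of
     the hexagon and at most [r'] to its left. *)
  case: (lerP y 1) => y1.
    have x1 := standard_fst_le1 hS hs (ltW y0).
    case: (lerP (x + y) 1) => xy1; last first.
      have := hr (x, y) xy1 x1 hpx (ltW y0) => /= ?; by lra.
    have hs' : (affine_map (-1) (-1) 0 1 0 0 @^-1` S) (- x - y, y).
      rewrite /preimage/= affine_map_reflection.
      by have := hs; congr S; congr (_, _); ring.
    have x1' := standard_fst_le1 (standard_reflection hS) hs' (ltW y0).
    have xm1 : x < -1.
      rewrite ltNge; apply/negP => xm1; apply: hh.
      by rewrite /hexagon /=; (split; [split|apply/andP; split]); lra.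
    have : y <= r (- x - y, y).
      apply: (hr (- x - y, y)) => /=; try lra.
      (* Since [- x - y] is positive here, [p <= q] turns the supporting line of slope [q] into the
         weaker one of slope [p] that [r'] requires. *)
      have : 0 <= (q - p) * (- x - y) by apply: mulr_ge0; lra.
      by lra.
    rewrite /r' /= affine_map_reflection; lra.
  (* Above [y = 1], the supporting line at [(0, 1)] forces [x <= 0], and the one at [(-1, 1)], with
     [q <= 1], forces [-1 <= x]. *)
  have x0 : x <= 0.
    rewrite leNgt; apply/negP => x0; have := mulr_ge0 p0 (ltW x0); lra.
  have xm1 : -1 <= x.
    case: (lerP 0 (x + y)) => xy0.
      have : q * (x + y) <= 1 * (x + y) by exact: ler_wpM2r.
      by lra.
    have : q * (x + y) <= 0 by apply: mulr_ge0_le0 => //; exact: ltW.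
    by lra.
  have := ht (x, y) y1 xm1 hpx x0 => /= ?; lra.
move=> /le_trans; apply; rewrite JB.
have := @J_hexagon_ge R; have := @triangle_area_gt0 R => s0p hexs.
(* In units of [triangle_area / 63] the total is at most [-72 + 51 * p + 21 * p ^ 2 + 34 * (1 - p) *
   (2 - p)], which factors as shown. *)
have : triangle_area * ((p - 1) * (55 * p + 4)) <= 0 :> R.
  by apply: mulr_ge0_le0; [exact: ltW|apply: mulr_le0_ge0; lra].
lra.
Qed.

Lemma J_weight_reflection S : bounded_region S ->
  J (weight (affine_map (-1) (-1) 0 1 0 0 @^-1` S) 0 1 (- (4 / 21))) =
  J (weight S 0 1 (- (4 / 21))).
Proof.
move=> bS.
have D1 : (-1) * 1 - (-1) * 0 = -1 :> R by ring.
have D0 : (-1) * 1 - (-1) * 0 != 0 :> R by rewrite D1 oppr_eq0 oner_neq0.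
have := J_affine_map 0 0 D0 (intg_weight 0 1 (- (4 / 21)) bS).
rewrite weight_comp D1 normrN normr1 invr1 [RHS]mul1r => <-.
by congr J; congr weight; ring.
Qed.

(** The slope [q] at [(0, 1)] of the reflected region is the slope of the original one at [(-1, 1)],
    so the reflection settles the case [q < p]. *)
Lemma standard_weight_le S : standard S -> J (weight S 0 1 (- (4 / 21))) <= 0.
Proof.
move=> hS; have hS' := standard_reflection hS.
have [p p01 hp] := standard_support hS.
have [q q01 hq] := standard_support hS'.
have [p0 p1] := andP p01; have [q0 q1] := andP q01.
case: (lerP p q) => pq.
  apply: (standard_weight_le_slopes hS p01 hp); exists q; first by rewrite pq.
  move=> x y h; have := hq (- x - y) y.
  rewrite /preimage /= affine_map_reflection.
  have -> : (- (- x - y) - y, y) = (x, y) by congr (_, _); ring.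
  by move=> /(_ h); lra.
rewrite -(J_weight_reflection (standard_bounded hS)).
apply: (standard_weight_le_slopes hS' q01 hq); exists p; first by rewrite (ltW pq).
move=> x y; rewrite /preimage /= affine_map_reflection => /hp; lra.
Qed.

(** Applying a bound to the rotated region replaces the form [(a, b)] by [(a - b, a)]; starting from
    [(0, 1)], this runs through the forms of all six edges. *)
Lemma standard_weight_le6 S : standard S ->
  [/\ J (weight S 0 1 (- (4 / 21))) <= 0, J (weight S (-1) 0 (- (4 / 21))) <= 0
    & J (weight S (-1) (-1) (- (4 / 21))) <= 0] /\
  [/\ J (weight S 0 (-1) (- (4 / 21))) <= 0, J (weight S 1 0 (- (4 / 21))) <= 0
    & J (weight S 1 1 (- (4 / 21))) <= 0].
Proof.
have D1 : 0 * 1 - (-1) * 1 = 1 :> R by ring.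
have D0 : 0 * 1 - (-1) * 1 != 0 :> R by rewrite D1 oner_neq0.
have rot (a b : R) : (forall S, standard S -> J (weight S a b (- (4 / 21))) <= 0) ->
    forall S, standard S -> J (weight S (a - b) a (- (4 / 21))) <= 0.
  move=> H U hU; have := H _ (standard_rotation hU).
  have := J_affine_map 0 0 D0 (intg_weight (a - b) a (- (4 / 21)) (standard_bounded hU)).
  rewrite weight_comp D1 normr1 invr1 [RHS]mul1r => <-.
  congr (J (weight _ _ _ _) <= 0); ring.
have H1 := standard_weight_le.
have H2 := rot _ _ H1; rewrite sub0r in H2.
have H3 := rot _ _ H2; rewrite subr0 in H3.
have H4 := rot _ _ H3; rewrite subrr in H4.
have H5 := rot _ _ H4; rewrite sub0r opprK in H5.
have H6 := rot _ _ H5; rewrite subr0 in H6.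
by move=> hS; split; split; [apply: H1|apply: H2|apply: H3|apply: H4|apply: H5|apply: H6].
Qed.

End StandardPosition.

(** * Affine transfer *)
Section Transfer.
Context {R : realType}.
Local Notation P := (measurableTypeR R * measurableTypeR R)%type.
Local Notation area := (@area R).
Implicit Types (S : set P) (A : set (plane R)).

(** * Trigonometry of the regular hexagon *)

Lemma cos_pi3 : cos (pi / 3) = 1 / 2 :> R.
Proof.
set c := cos (pi / 3).
have p0 := pi_gt0 R.
have c0 : 0 < c by apply: cos_gt0_pihalf; lra.
have : cos (pi / 3 + pi / 3 + pi / 3) = -1 :> R.
  rewrite -cospi; congr cos; lra.
rewrite !cosD !sinD -/c.
have := cos2Dsin2 (pi / 3 : R); rewrite -/c; set s := sin _ => h1 h2.
(* The triple angle formula gives [4 * c ^ 3 - 3 * c = -1], whose only positive root is [1 / 2]. *)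
have : (c + 1) * (2 * c - 1) ^+ 2 = 0.
  have s2 : s ^+ 2 = 1 - c ^+ 2 by rewrite -h1; ring.
  have : c * c * c - 3 * c * s ^+ 2 = -1 by rewrite -h2; ring.
  rewrite s2 => h3.
  have -> : (c + 1) * (2 * c - 1) ^+ 2 = (c * c * c - 3 * c * (1 - c ^+ 2)) + 1 by ring.
  by rewrite h3 addNr.
move/eqP; rewrite mulf_eq0 sqrf_eq0 => /orP[/eqP|/eqP]; lra.
Qed.

Lemma sin_pi3_gt0 : 0 < sin (pi / 3) :> R.
Proof. by apply: sin_gt0_pi; have := pi_gt0 R; lra. Qed.

(** Real part of the identity [w ^ 2 = w - 1] for the sixth root of unity [w] of argument [pi / 3].
    This recurrence yields all vertices from the first two. *)
Lemma cos_pi3_step (x : R) : cos (x + pi / 3 + pi / 3) = cos (x + pi / 3) - cos x.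
Proof.
rewrite [LHS]cosD cos_pi3; rewrite sinD cosD cos_pi3.
have := cos2Dsin2 (pi / 3 : R); rewrite cos_pi3; set s := sin (pi / 3) => h.
have : s * s = 3 / 4 by rewrite -expr2; lra.
set u := cos x; set v := sin x => hs.
have -> : (v * (1 / 2) + u * s) * s = v * s * (1/2) + u * (s * s) by ring.
rewrite hs; lra.
Qed.

Lemma sin_pi3_step (x : R) : sin (x + pi / 3 + pi / 3) = sin (x + pi / 3) - sin x.
Proof.
rewrite [LHS]sinD cos_pi3; rewrite sinD cosD cos_pi3.
have := cos2Dsin2 (pi / 3 : R); rewrite cos_pi3; set s := sin (pi / 3) => h.
have : s * s = 3 / 4 by rewrite -expr2; lra.
set u := cos x; set v := sin x => hs.
have -> : (u * (1 / 2) - v * s) * s = u * s * (1/2) - v * (s * s) by ring.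
rewrite hs; lra.
Qed.

(** The affine chart sending the origin to [o], and [(1, 0)] and [(0, 1)] to the vertices of index 0
    and 1. *)
Definition hexagon_chart (o : plane R) (r theta : R) : P -> P :=
  affine_map (r * cos theta) (r * cos (theta + pi / 3))
             (r * sin theta) (r * sin (theta + pi / 3)) o.1 o.2.

Lemma hexagon_chart_det (r theta : R) : 0 < r ->
  r * cos theta * (r * sin (theta + pi / 3))
    - r * cos (theta + pi / 3) * (r * sin theta) != 0.
Proof.
move=> r0; rewrite sinD cosD.
have -> : r * cos theta * (r * (sin theta * cos (pi / 3) + cos theta * sin (pi / 3))) -
  r * (cos theta * cos (pi / 3) - sin theta * sin (pi / 3)) * (r * sin theta) =
  r * r * (sin (pi / 3) * (cos theta ^+ 2 + sin theta ^+ 2)) by ring.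
rewrite cos2Dsin2 mulr1; apply: lt0r_neq0; apply: mulr_gt0; last exact: sin_pi3_gt0.
exact: mulr_gt0.
Qed.

Lemma regular_hexagon_vertexE (o : plane R) (r theta : R) :
  let w := regular_hexagon_vertex o r theta in
  let M := hexagon_chart o r theta in
  [/\ w (@Ordinal 6 0 isT) = M (1, 0), w (@Ordinal 6 1 isT) = M (0, 1)
    & w (@Ordinal 6 2 isT) = M (-1, 1)] /\
  [/\ w (@Ordinal 6 3 isT) = M (-1, 0), w (@Ordinal 6 4 isT) = M (0, -1)
    & w (@Ordinal 6 5 isT) = M (1, -1)].
Proof.
pose a (k : nat) : R := theta + k%:R * (pi / 3).
have a0 : a 0%N = theta by rewrite /a mul0r addr0.
have a1 : a 1%N = theta + pi / 3 by rewrite /a mul1r.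
have aS k : a k.+2 = a k + pi / 3 + pi / 3 by rewrite /a -[k.+2]addn2 natrD; ring.
have aS1 k : a k.+1 = a k + pi / 3 by rewrite /a -[k.+1]addn1 natrD; ring.
have cS k : cos (a k.+2) = cos (a k.+1) - cos (a k) by rewrite aS aS1 cos_pi3_step.
have sS k : sin (a k.+2) = sin (a k.+1) - sin (a k) by rewrite aS aS1 sin_pi3_step.
case: o => o1 o2; rewrite /regular_hexagon_vertex /hexagon_chart /affine_map /=.
rewrite -!/(a _) !cS !sS a0 a1.
by split; split; congr (_, _) => /=; ring.
Qed.

Lemma nondegenerate_affineP (T : plane R -> plane R) : nondegenerate_affine T ->
  exists a b c d e f : R, a * d - b * c != 0 /\ T = affine_map a b c d e f.
Proof.
move=> [L [t [Lbij LT]]].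
pose e1 : plane R := (1, 0); pose e2 : plane R := (0, 1).
have zE (x y : R) : (x, y) = x *: e1 + y *: e2 :> plane R.
  by congr (_, _) => /=; rewrite /GRing.scale /=; ring.
have LE (x y : R) : L (x, y) = x *: L e1 + y *: L e2.
  by rewrite zE linearD !linearZ.
have LE1 (x y : R) : (L (x, y)).1 = x * (L e1).1 + y * (L e2).1 by rewrite LE.
have LE2 (x y : R) : (L (x, y)).2 = x * (L e1).2 + y * (L e2).2 by rewrite LE.
exists (L e1).1, (L e2).1, (L e1).2, (L e2).2, t.1, t.2; split; last first.
  apply/funext => -[x y]; rewrite LT /affine_map /=.
  rewrite [L (x, y)]surjective_pairing LE1 LE2.
  by congr (_, _) => /=; congr (_ + _); ring.
have Linj (x y : R) : (L (x, y)).1 = 0 -> (L (x, y)).2 = 0 -> x = 0 /\ y = 0.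
  move=> h1 h2; have : L (x, y) = L 0 by rewrite linear0 [LHS]surjective_pairing h1 h2.
  by move=> /(bij_inj Lbij)[].
apply/eqP => D0.
set a := (L e1).1 in LE1 D0; set b := (L e2).1 in LE1 D0.
set c := (L e1).2 in LE2 D0; set d := (L e2).2 in LE2 D0.
(* If the determinant vanishes, [(d, - c)] and [(b, - a)] lie in the kernel; injectivity then makes
   the whole matrix zero. *)
have [d0 c0] : d = 0 /\ - c = 0 by apply: Linj; rewrite ?LE1 ?LE2; lra.
have [b0 a0] : b = 0 /\ - a = 0 by apply: Linj; rewrite ?LE1 ?LE2; lra.
have [/eqP] : (1 : R) = 0 /\ (0 : R) = 0 by apply: Linj; rewrite ?LE1 ?LE2; lra.
by rewrite oner_eq0.
Qed.

Lemma affine_map_comp (a b c d e f a' b' c' d' e' f' : R) :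
  affine_map a b c d e f \o affine_map a' b' c' d' e' f' =
  affine_map (a * a' + b * c') (a * b' + b * d') (c * a' + d * c') (c * b' + d * d')
    (a * e' + b * f' + e) (c * e' + d * f' + f).
Proof. by apply/funext => -[x y]; rewrite /affine_map /=; congr (_, _); ring. Qed.

Lemma convex_set_plane A : convex_set A -> plane_convex (A : set P).
Proof.
move=> cA x y u v t h1 h2 /andP[t0 t1].
have := cA (u, v) (x, y) (Itv01 t0 t1); rewrite !inE => /(_ h2 h1).
by congr A; congr (_, _); exact: addrC.
Qed.

Lemma interior_affine_map (a b c d e f : R) A (x0 y0 k : R) :
  a * d - b * c != 0 -> 0 < k ->
  (forall x y, `|x - x0| <= k -> `|y - y0| <= k -> A (affine_map a b c d e f (x, y))) ->
  interior A (affine_map a b c d e f (x0, y0)).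
Proof.
move=> D0 k0 H; set D := a * d - b * c in D0.
have D1 : 0 < `|D| by rewrite normr_gt0.
(* [N] bounds the row sums of the adjugate matrix, so the inverse map sends a ball of radius
   [k * |D| / N] into the box of half-width [k]; the added 1 keeps [N] positive. *)
pose N := `|a| + `|b| + `|c| + `|d| + 1.
have na := normr_ge0 a; have nb := normr_ge0 b.
have nc := normr_ge0 c; have nd := normr_ge0 d.
have N0 : 0 < N by rewrite /N; lra.
pose eps := k * `|D| / N.
have e0 : 0 < eps by rewrite /eps divr_gt0// mulr_gt0.
have eN : eps * N = k * `|D| by rewrite /eps mulfVK//; exact: lt0r_neq0.
apply/nbhs_ballP; exists eps => //= -[u v] []; rewrite /ball/= /affine_map/=.
set u0 := a * x0 + b * y0 + e; set v0 := c * x0 + d * y0 + f => hu hv.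
pose x := (d * (u - e) - b * (v - f)) / D.
pose y := (a * (v - f) - c * (u - e)) / D.
have -> : (u, v) = affine_map a b c d e f (x, y).
  by rewrite /affine_map /= /x /y; congr (_, _); rewrite /D; field.
have bnd (p q : R) : `|p| + `|q| <= N ->
    `|p * (u0 - u) + q * (v0 - v)| <= k * `|D|.
  move=> pq; rewrite -eN (le_trans (ler_normD _ _))// !normrM.
  have h1 := ler_wpM2l (normr_ge0 p) (ltW hu).
  have h2 := ler_wpM2l (normr_ge0 q) (ltW hv).
  have := ler_wpM2l (ltW e0) pq; lra.
apply: H.
- rewrite -(ler_pM2r D1) -normrM.
  have -> : (x - x0) * D = - d * (u0 - u) + b * (v0 - v).
    by rewrite /x mulrBl mulfVK// /u0 /v0 /D; ring.
  by apply: bnd; rewrite normrN /N; lra.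
- rewrite -(ler_pM2r D1) -normrM.
  have -> : (y - y0) * D = c * (u0 - u) + - a * (v0 - v).
    by rewrite /y mulrBl mulfVK// /u0 /v0 /D; ring.
  by apply: bnd; rewrite normrN /N; lra.
Qed.

(* A point strictly between an interior point (here the center of the hexagon)
   and a point of a convex set is interior. *)
Lemma not_interior_ray (a b c d e f : R) A (x0 y0 t : R) :
  a * d - b * c != 0 -> plane_convex (affine_map a b c d e f @^-1` A) ->
  hexagon `<=` affine_map a b c d e f @^-1` A ->
  ~ interior A (affine_map a b c d e f (x0, y0)) -> 1 < t ->
  ~ A (affine_map a b c d e f (t * x0, t * y0)).
Proof.
move=> D0 cA hA nI t1 At; apply: nI.
have t0 : 0 < t by lra.
have t0' : t != 0 by exact: lt0r_neq0.
have s0 : 0 < 1 - t^-1 by rewrite subr_gt0 invf_lt1.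
have s0' : 1 - t^-1 != 0 by exact: lt0r_neq0.
have tt : t - 1 != 0 by apply: lt0r_neq0; lra.
(* The square of half-width [1 / 2] around the center lies in the hexagon; the homothety of ratio
   [1 - t^-1] centered at [(t * x0, t * y0)] carries it to a square around [(x0, y0)]. *)
apply: (@interior_affine_map _ _ _ _ _ _ _ _ _ ((1 - t^-1) / 2)) => //.
  by apply: divr_gt0.
move=> x y hx hy.
have hex : hexagon ((x - x0) / (1 - t^-1), (y - y0) / (1 - t^-1)).
  have : `|(x - x0) / (1 - t^-1)| <= 1 / 2.
    by rewrite normrM normfV (gtr0_norm s0) ler_pdivrMr//; lra.
  have : `|(y - y0) / (1 - t^-1)| <= 1 / 2.
    by rewrite normrM normfV (gtr0_norm s0) ler_pdivrMr//; lra.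
  rewrite !ler_norml => /andP[? ?] /andP[? ?].
  by rewrite /hexagon /=; (split; [split|apply/andP; split]); lra.
have := cA _ _ _ _ t^-1 (hA _ hex) At.
have -> : 0 <= t^-1 <= 1 by rewrite invr_ge0 (ltW t0) invf_le1// ltW.
move=> /(_ isT); congr A; congr (affine_map _ _ _ _ _ _ (_, _)).
  by rewrite mulrC divfK// mulrA mulVf// mul1r subrK.
by rewrite mulrC divfK// mulrA mulVf// mul1r subrK.
Qed.

Lemma bounded_region_convex_body A : convex_body A -> bounded_region (A : set P).
Proof.
move=> [cA bA _]; split; first exact: closed_measurable_plane.
have [M [_ HM]] := bA; exists (M + 1) => z Az.
have : `|z : plane R| <= M + 1 by apply: HM => //; lra.
by rewrite prod_normE ge_max => /andP[].
Qed.

(** Closedness puts the vertices in [A]; since they are not interior points, no point further out on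
    their rays from the center is in [A]. *)
Lemma inscribed_standard (a b c d e f : R) A :
  a * d - b * c != 0 -> convex_body A ->
  (forall w : P, w \in [:: (1, 0); (0, 1); (-1, 1); (-1, 0); (0, -1); (1, -1)] ->
    boundary A (affine_map a b c d e f w)) ->
  standard (affine_map a b c d e f @^-1` A).
Proof.
move=> D0 cbA hv; have [cA bA convA] := cbA.
have inA w : boundary A w -> A w.
  by move=> [+ _]; rewrite -(closure_id A).1.
have cS : plane_convex (affine_map a b c d e f @^-1` A).
  by apply: plane_convex_preimage; exact: convex_set_plane.
have B1 := hv (1, 0); have B2 := hv (0, 1); have B3 := hv (-1, 1).
have B4 := hv (-1, 0); have B5 := hv (0, -1); have B6 := hv (1, -1).
rewrite !inE !eqxx ?orbT in B1 B2 B3 B4 B5 B6.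
move: B1 B2 B3 B4 B5 B6 => /(_ isT) B1 /(_ isT) B2 /(_ isT) B3 /(_ isT) B4 /(_ isT) B5 /(_ isT) B6.
have hA : hexagon `<=` affine_map a b c d e f @^-1` A.
  by apply: hexagon_sub_convex => //; exact: inA.
split => //.
- by apply: bounded_region_preimage => //; exact: bounded_region_convex_body.
- by split; split; exact: inA.
- have ray x y t := @not_interior_ray a b c d e f A x y t D0 cS hA.
  move=> t t1.
  have := ray _ _ _ B1.2 t1; have := ray _ _ _ B2.2 t1; have := ray _ _ _ B3.2 t1.
  have := ray _ _ _ B4.2 t1; have := ray _ _ _ B5.2 t1; have := ray _ _ _ B6.2 t1.
  by rewrite !mulrN !mulr1 !mulr0 /preimage /= => *; split; split.
Qed.

Lemma J_setE S g : J (fun z => \1_S z * g z) = \int[area]_(z in S) g z :> R.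
Proof.
rewrite Rintegral_mkcond; congr J; apply/funext => z.
by rewrite /patch indicE; case: ifPn => _; rewrite ?mul1r ?mul0r.
Qed.

Lemma centroidE A : measurable (A : set P) ->
  centroid A = ((J (weight A 0 0 1))^-1 * J (weight A 1 0 0),
                (J (weight A 0 0 1))^-1 * J (weight A 0 1 0)).
Proof.
move=> mA; rewrite J_area// /centroid.
have E1 : J (weight A 1 0 0) = \int[area]_(z in A) z.1.
  rewrite -J_setE; congr J; apply/funext => z.
  by rewrite /weight /affine_fun; ring.
have E2 : J (weight A 0 1 0) = \int[area]_(z in A) z.2.
  rewrite -J_setE; congr J; apply/funext => z.
  by rewrite /weight /affine_fun; ring.
by rewrite E1 E2.
Qed.

(** Area and first moments of [A] are affine combinations of those of [S] times the common factor
    [|D|], which cancels in the quotient. *)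
Lemma centroid_affine_map (a b c d e f : R) A (S := affine_map a b c d e f @^-1` A) :
  a * d - b * c != 0 -> bounded_region (A : set P) -> 0 < J (weight S 0 0 1) ->
  centroid A = affine_map a b c d e f
    (J (weight S 1 0 0) / J (weight S 0 0 1), J (weight S 0 1 0) / J (weight S 0 0 1)).
Proof.
move=> D0 bA m0; rewrite centroidE; last by case: bA.
have bS : bounded_region S by exact: bounded_region_preimage.
have T u v w := J_affine_map e f D0 (intg_weight u v w bA).
have T1 := T 1 0 0; have T2 := T 0 1 0; have T3 := T 0 0 1.
rewrite weight_comp -/S J_weight// in T1.
rewrite weight_comp -/S J_weight// in T2.
rewrite weight_comp -/S J_weight// in T3.
move: T1 T2 T3 m0; set m := J (weight S 0 0 1); set X := J (weight S 1 0 0).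
set Y := J (weight S 0 1 0); set m' := J (weight A 0 0 1).
set X' := J (weight A 1 0 0); set Y' := J (weight A 0 1 0).
set D := `|_|; have D1 : D != 0 by rewrite normr_eq0.
move=> T1 T2 T3 m0; have mn0 : m != 0 by exact: lt0r_neq0.
have m'E : m' = D * m.
  have -> : m = D^-1 * m' by rewrite -T3; ring.
  by rewrite mulrA divff// mul1r.
have X'E : X' = D * (a * X + b * Y + e * m).
  have -> : a * X + b * Y + e * m = D^-1 * X' by rewrite -T1; ring.
  by rewrite mulrA divff// mul1r.
have Y'E : Y' = D * (c * X + d * Y + f * m).
  have -> : c * X + d * Y + f * m = D^-1 * Y' by rewrite -T2; ring.
  by rewrite mulrA divff// mul1r.
rewrite m'E X'E Y'E /affine_map /=; congr (_, _); field; by rewrite mn0 D1.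
Qed.

Lemma standard_area_gt0 S : standard S -> 0 < J (weight S 0 0 1).
Proof.
move=> hS; have [[s1 s2 s3] [s4 s5 s6]] := standard_vertices hS.
have HS : hexagon `<=` S by apply: hexagon_sub_convex => //; exact: standard_convex hS.
have bH := @bounded_region_hexagon R.
have : J (weight hexagon 0 0 1) <= J (weight S 0 0 1).
  apply: le_J; [exact: intg_weight|by apply: intg_weight; exact: standard_bounded hS|].
  move=> z; rewrite /weight /affine_fun !mul0r !add0r !mulr1.
  have [[hh ->]|[hh ->]] := indicP hexagon z; last by rewrite indicE.
  by have [[_ ->//]|[ns _]] := indicP S z; exfalso; apply: ns; exact: HS.
have := @J_hexagon_ge R; have := @triangle_area_gt0 R; lra.
Qed.

(** Divided by the area, the six integral bounds become the six inequalities of the hexagon scaled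
    by [4 / 21]. *)
Lemma standard_centroid S : standard S ->
  hexagon ((4 / 21)^-1 * (J (weight S 1 0 0) / J (weight S 0 0 1)),
           (4 / 21)^-1 * (J (weight S 0 1 0) / J (weight S 0 0 1))).
Proof.
move=> hS; have bS := standard_bounded hS; have m0 := standard_area_gt0 hS.
have [[h1 h2 h3] [h4 h5 h6]] := standard_weight_le6 hS.
rewrite J_weight// in h1; rewrite J_weight// in h2; rewrite J_weight// in h3.
rewrite J_weight// in h4; rewrite J_weight// in h5; rewrite J_weight// in h6.
move: m0 h1 h2 h3 h4 h5 h6.
set m := J (weight S 0 0 1); set X := J (weight S 1 0 0); set Y := J (weight S 0 1 0).
move=> m0 h1 h2 h3 h4 h5 h6.
have key (z : R) : z <= 4 / 21 * m -> z / m <= 4 / 21 by rewrite ler_pdivrMr.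
have k1 := key X ltac:(lra); have k2 := key (- X) ltac:(lra).
have k3 := key Y ltac:(lra); have k4 := key (- Y) ltac:(lra).
have k5 := key (X + Y) ltac:(lra); have k6 := key (- X - Y) ltac:(lra).
rewrite !mulrDl !mulNr in k1 k2 k3 k4 k5 k6.
have -> : (4 / 21)^-1 = 21 / 4 :> R by field.
by rewrite /hexagon /=; (split; [split|apply/andP; split]); lra.
Qed.

End Transfer.

(** * Return to an arbitrary affine-regular hexagon *)

Lemma hexagon_chart_sub_regular_hexagon (R : realType) (o : plane R) (r theta : R) z :
  hexagon z -> regular_hexagon o r theta (hexagon_chart o r theta z).
Proof.
(* The convex hull is an intersection, so it suffices to treat each convex [B] containing the
   vertices; its preimage under the chart contains the standard hexagon. *)
move=> hz B [cB hB].
have cB' : plane_convex (hexagon_chart o r theta @^-1` B).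
  by apply: plane_convex_preimage; exact: convex_set_plane.
have [[w1 w2 w3] [w4 w5 w6]] := regular_hexagon_vertexE o r theta.
apply: (hexagon_sub_convex cB') hz; rewrite /preimage /=.
- by rewrite -w1; apply: hB; exists (@Ordinal 6 0 isT).
- by rewrite -w2; apply: hB; exists (@Ordinal 6 1 isT).
- by rewrite -w3; apply: hB; exists (@Ordinal 6 2 isT).
- by rewrite -w4; apply: hB; exists (@Ordinal 6 3 isT).
- by rewrite -w5; apply: hB; exists (@Ordinal 6 4 isT).
- by rewrite -w6; apply: hB; exists (@Ordinal 6 5 isT).
Qed.

Lemma homothetyE (R : realType) (c x : plane R) (k : R) :
  homothety c k x = (c.1 + k * (x.1 - c.1), c.2 + k * (x.2 - c.2)).
Proof. by []. Qed.

Theorem mainTheorem1 (R : realType) (A : set (plane R)) (hA : convex_body A)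
    (H : set (plane R)) (v : 'I_6 -> plane R) (c : plane R)
    (hH : affine_regular_hexagon H v c) (hHA : inscribed v A) :
  (homothety c (4 / 21) @` H) (centroid A).
Proof.
have [T [ o [r [theta [nT r0 HE vE cE]]]]] := hH.
have [a [b [a' [b' [e [f [D0 TE]]]]]]] := nondegenerate_affineP nT.
have D1 := hexagon_chart_det theta r0.
pose M := T \o hexagon_chart o r theta.
have ME := erefl M; rewrite {2}/M TE /hexagon_chart affine_map_comp in ME.
set m11 := a * _ + _ in ME; set m12 := a * _ + _ in ME.
set m21 := a' * _ + _ in ME; set m22 := a' * _ + _ in ME.
set m1 := _ + _ + e in ME; set m2 := _ + _ + f in ME.
have DM : m11 * m22 - m12 * m21 != 0.
  have -> : m11 * m22 - m12 * m21 = (a * b' - b * a') *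
   (r * cos theta * (r * sin (theta + pi / 3))
    - r * cos (theta + pi / 3) * (r * sin theta)).
    by rewrite /m11 /m12 /m21 /m22; ring.
  exact: mulf_neq0.
have [[w1 w2 w3] [w4 w5 w6]] := regular_hexagon_vertexE o r theta.
have hS : standard (affine_map m11 m12 m21 m22 m1 m2 @^-1` A).
  apply: inscribed_standard => // w; rewrite -ME /M /= => hw.
  suff [k ->] : exists k, hexagon_chart o r theta w = regular_hexagon_vertex o r theta k.
    by rewrite -vE; exact: hHA.
  move: hw; rewrite !inE => /or4P[/eqP->|/eqP->|/eqP->|/or3P[/eqP->|/eqP->|/eqP->]].
  - by exists (@Ordinal 6 0 isT).
  - by exists (@Ordinal 6 1 isT).
  - by exists (@Ordinal 6 2 isT).
  - by exists (@Ordinal 6 3 isT).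
  - by exists (@Ordinal 6 4 isT).
  - by exists (@Ordinal 6 5 isT).
have hc := standard_centroid hS.
rewrite (centroid_affine_map DM (bounded_region_convex_body hA) (standard_area_gt0 hS)).
set S := _ @^-1` _ in hc *.
set gx := J (weight S 1 0 0) / _ in hc *; set gy := J (weight S 0 1 0) / _ in hc *.
(* The witness is the image of the centroid of [S] dilated by [21 / 4]; since [c] is the image of
   the origin, the homothety at [c] undoes the dilation. *)
exists (M ((4 / 21)^-1 * gx, (4 / 21)^-1 * gy)).
  rewrite HE; exists (hexagon_chart o r theta ((4 / 21)^-1 * gx, (4 / 21)^-1 * gy)) => //.
  exact: hexagon_chart_sub_regular_hexagon hc.
have -> : c = (m1, m2).
  rewrite cE TE /affine_map /m1 /m2; congr (_, _); by case: (o).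
rewrite homothetyE ME /affine_map /=; congr (_, _); by field.
Qed.
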